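(* Let $r\ge1$ be an integer, let $(d_n)_{n\ge1}$ be a sequence of positive real numbers, and let $D(z)=\sum_{n=1}^\infty d_nz^n$. Let $c_n^{(r)}$ be the coefficients defined by $$\frac1{(1-D(z))^r}=\sum_{n=0}^\infty c_n^{(r)}z^n .$$ Then for every $n\ge1$, $$c_n^{(r)}=\sum_{j=1}^{n}\binom{r+j-1}{j}\sum_{\substack{n_1+\cdots+n_j=n\\ n_i\ge1}}d_{n_1}\cdots d_{n_j}=\frac1{n!}\sum_{j=1}^{n}(r)_j\,B_{n,j}(1!\,d_1,2!\,d_2,\ldots).$$
   Context: The series are understood as (formal) power series in $z$; since $D$ has zero constant term, $(1-D(z))^{-r}$ is well defined. The inner sum is over ordered $j$-tuples $(n_1,\dots,n_j)$ of positive integers with sum $n$. $(r)_j=r(r+1)\cdots(r+j-1)$. $B_{n,j}$ is the partial exponential Bell polynomial $$B_{n,j}(x_1,x_2,\ldots)=\sum\frac{n!}{m_1!m_2!\cdots}\prod_{\ell\ge1}\left(\frac{x_\ell}{\ell!}\right)^{m_\ell},$$ the sum being over all nonnegative integers $m_1,m_2,\ldots$ with $m_1+m_2+\cdots=j$ and $m_1+2m_2+3m_3+\cdots=n$. *)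

(* Defs.v *)
From HB Require Import structures.
From mathcomp Require Import all_boot all_order all_algebra.
From mathcomp Require Import boolp reals.
Set Implicit Arguments. Unset Strict Implicit. Unset Printing Implicit Defensive.
Import Order.TTheory GRing.Theory Num.Theory.
Local Open Scope ring_scope.

(* A formal power series is wrapped in a record, rather than identified with
   nat -> R, so that its product is the Cauchy product below and not the
   pointwise product of functions. *)
Record fps (R : Type) := Fps { coef_fps :> nat -> R }.

HB.instance Definition _ (R : Type) := gen_eqMixin (fps R).
HB.instance Definition _ (R : Type) := gen_choiceMixin (fps R).

Lemma fpsP (R : Type) (f g : fps R) : (forall n, f n = g n) -> f = g.
Proof. by case: f g => [f] [g] /= fg; congr Fps; apply: funext. Qed.

Section FpsZmodule.
Variable R : zmodType.
Implicit Types f g : fps R.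

Definition fps_zero : fps R := Fps (fun=> 0).
Definition fps_opp f : fps R := Fps (fun n => - f n).
Definition fps_add f g : fps R := Fps (fun n => f n + g n).

Let addA : associative fps_add.
Proof. by move=> f g h; apply: fpsP => n /=; rewrite addrA. Qed.
Let addC : commutative fps_add.
Proof. by move=> f g; apply: fpsP => n /=; rewrite addrC. Qed.
Let add0 : left_id fps_zero fps_add.
Proof. by move=> f; apply: fpsP => n /=; rewrite add0r. Qed.
Let addN : left_inverse fps_zero fps_opp fps_add.
Proof. by move=> f; apply: fpsP => n /=; rewrite addNr. Qed.

HB.instance Definition _ := GRing.isZmodule.Build (fps R) addA addC add0 addN.

End FpsZmodule.

Section FpsRing.
Variable R : comNzRingType.
Implicit Types f g h : fps R.

Definition fps_one : fps R := Fps (fun n => (n == 0)%:R).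
Definition fps_mul f g : fps R :=
  Fps (fun n => \sum_(k < n.+1) f k * g (n - k)%N).

Let trunc N f : {poly R} := \poly_(i < N.+1) f i.

Let coef_trunc N f n : (n <= N)%N -> (trunc N f)`_n = f n.
Proof. by move=> le_nN; rewrite coef_poly ltnS le_nN. Qed.

Let coef_mul N f g n : (n <= N)%N -> fps_mul f g n = (trunc N f * trunc N g)`_n.
Proof.
move=> le_nN; rewrite coefM; apply: eq_bigr => -[k /= lt_kn] _.
by rewrite !coef_trunc // (leq_trans _ le_nN) // leq_subr.
Qed.

Let mulC : commutative fps_mul.
Proof. by move=> f g; apply: fpsP => n; rewrite !(@coef_mul n) // mulrC. Qed.

Let mulA : associative fps_mul.
Proof.
move=> f g h; apply: fpsP => n.
have -> : fps_mul f (fps_mul g h) n = (trunc n f * (trunc n g * trunc n h))`_n.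
  rewrite (@coef_mul n) // !coefM; apply: eq_bigr => -[k /= lt_kn] _.
  by congr (_ * _); rewrite coef_trunc ?leq_subr // (@coef_mul n) ?leq_subr.
rewrite mulrA (@coef_mul n) // !coefM; apply: eq_bigr => -[k /= lt_kn] _.
by congr (_ * _); rewrite coef_trunc // (@coef_mul n).
Qed.

Let mul1 : left_id fps_one fps_mul.
Proof.
move=> f; apply: fpsP => n /=.
rewrite big_ord_recl /= mul1r subn0 big1 ?addr0 // => i _.
by rewrite mul0r.
Qed.

Let mulDl : left_distributive fps_mul +%R.
Proof.
move=> f g h; apply: fpsP => n /=.
by rewrite -big_split /=; apply: eq_bigr => i _; rewrite mulrDl.
Qed.

Let one_neq0 : fps_one != 0.
Proof.
apply/eqP => /(congr1 (fun f : fps R => f 0%N)) /= /eqP.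
by rewrite oner_eq0.
Qed.

HB.instance Definition _ := GRing.Zmodule_isComNzRing.Build (fps R)
  mulA mulC mul1 mulDl one_neq0.

End FpsRing.

Section FpsUnitRing.
Variable R : comUnitRingType.
Implicit Types f g : fps R.

Definition fps_unit : {pred fps R} := [pred f : fps R | f 0%N \is a GRing.unit].

(* The first n coefficients of f^-1, from the recurrence
   g_n = f_0^-1 * ([n = 0] - \sum_(1 <= k <= n) f_k g_(n-k)). *)
Fixpoint fps_inv_seq f n : seq R :=
  if n is n'.+1 then
    let s := fps_inv_seq f n' in
    rcons s ((f 0%N)^-1 *
             ((n' == 0)%:R - \sum_(k < n') f k.+1 * s`_(n' - k.+1)))
  else [::].

(* As for every unitRingType, the inverse of a non-unit f is f itself. *)
Definition fps_inv f : fps R :=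
  if f \in fps_unit then Fps (fun n => (fps_inv_seq f n.+1)`_n) else f.

Let size_inv_seq f n : size (fps_inv_seq f n) = n.
Proof. by elim: n => //= n IHn; rewrite size_rcons IHn. Qed.

Let nth_inv_seq f m n : (n < m)%N ->
  (fps_inv_seq f m)`_n = (fps_inv_seq f n.+1)`_n.
Proof.
elim: m => // m IHm; rewrite ltnS leq_eqVlt => /predU1P[-> // | lt_nm].
by rewrite -(IHm lt_nm) [in LHS]/= nth_rcons size_inv_seq lt_nm.
Qed.

Let inv_seqE f n : (fps_inv_seq f n.+1)`_n = (f 0%N)^-1 *
  ((n == 0)%:R - \sum_(k < n) f k.+1 * (fps_inv_seq f (n - k.+1).+1)`_(n - k.+1)).
Proof.
rewrite [LHS]/= nth_rcons size_inv_seq ltnn eqxx; congr (_ * (_ - _)).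
apply: eq_bigr => -[k /= lt_kn] _; congr (_ * _).
by rewrite nth_inv_seq // -subSn // subSS leq_subr.
Qed.

Let mulVf : {in fps_unit, left_inverse 1 fps_inv *%R}.
Proof.
move=> f Uf; rewrite mulrC; apply: fpsP => n.
have -> : (f * fps_inv f) n = \sum_(k < n.+1) f k * fps_inv f (n - k)%N by [].
have invE m : fps_inv f m = (fps_inv_seq f m.+1)`_m by rewrite /fps_inv Uf.
rewrite big_ord_recl subn0 invE inv_seqE mulVKr //.
under [X in _ + X]eq_bigr do rewrite invE.
exact: subrK.
Qed.

Let unitPl f g : g * f = 1 -> fps_unit f.
Proof.
move=> /(congr1 (fun h : fps R => h 0%N)).
rewrite [LHS](_ : _ = \sum_(k < 1) g k * f (0 - k)%N) // big_ord1 /= => gf1.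
by apply/unitrPr; exists (g 0%N); rewrite mulrC.
Qed.

Let inv_out : {in [predC fps_unit], fps_inv =1 id}.
Proof. by move=> f; rewrite inE /= /fps_inv => /negPf ->. Qed.

HB.instance Definition _ := GRing.ComNzRing_hasMulInverse.Build (fps R)
  mulVf unitPl inv_out.

End FpsUnitRing.

(* The series \sum_(n >= 1) d_n z^n; the value d 0 plays no role. *)
Definition fps_pos (R : nmodType) (d : nat -> R) : fps R :=
  Fps (fun n => if n == 0%N then 0 else d n).

(* Rising factorial (r)_j = r (r+1) ... (r+j-1). *)
Definition rising (r j : nat) : nat := \prod_(i < j) (r + i).

(* Sum of d_(n_1) ... d_(n_j) over the ordered j-tuples of positive integers
   with sum n; the entries of such a tuple are at most n, whence 'I_n.+1. *)
Definition composition_sum (R : pzSemiRingType) (d : nat -> R) (n j : nat) : R :=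
  \sum_(t : j.-tuple 'I_n.+1 |
        [forall i, 0 < tnth t i]%N && (\sum_(i < j) tnth t i == n)%N)
    \prod_(i < j) d (tnth t i).

(* Partial exponential Bell polynomial B_(n,j)(x_1, x_2, ...).  The
   multiplicity m_l is stored at the ordinal i with l = i.+1; the constraint
   \sum_l l m_l = n forces m_l <= n for all l and m_l = 0 for l > n, so that
   finitely supported families are exactly the functions from 'I_n to 'I_n.+1. *)
Definition bell (R : fieldType) (n j : nat) (x : nat -> R) : R :=
  \sum_(m : {ffun 'I_n -> 'I_n.+1} |
        (\sum_(i < n) m i == j)%N && (\sum_(i < n) i.+1 * m i == n)%N)
    (n`!)%:R / (\prod_(i < n) (m i)`!)%:R *
    \prod_(i < n) (x i.+1 / (i.+1)`!%:R) ^+ m i.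

(* Main.v *)
Require Import Defs.
From mathcomp Require Import all_boot all_order all_algebra.
From mathcomp Require Import reals ring.
Import Order.TTheory GRing.Theory Num.Theory.
Local Open Scope ring_scope.

(** Write D for the series with coefficients d_n. The identity splits into an
    expansion of (1 - D)^-r in powers of D and two expansions of the
    coefficients of D^j.

    Since D has zero constant term, D^m has no term of degree below m, so only
    the powers D^j with j <= n matter for the coefficient of z^n. The partial
    sum of the negative binomial series up to j = n satisfies, in any
    commutative ring, (1 - x)^r * (partial sum) = 1 + x^(n+1) q for some q
    ([exp_mul_neg_binomial]); taking x = D and dividing by (1 - D)^r shows that
    the coefficient of z^n in (1 - D)^-r is the sum over j of 'C(r + j - 1, j)
    times that of D^j ([coef_inv_exp_sub1]).

    The coefficient of z^n in D^j is computed in two ways. Expanding the product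
    of j equal factors yields the sum over compositions
    ([coef_fps_pos_exp]). Replacing D by the polynomial
    d_1 z + ... + d_n z^n and applying the multinomial theorem groups the same
    terms by multiplicities and yields j! / n! times a Bell polynomial
    ([coef_fps_pos_exp_bell]); the factor j! turns the binomial coefficient
    into the rising factorial.

    Both expansions rest on [coef_fps_prod], which gives a coefficient of a
    finite product of series as a sum over finite functions. The multinomial
    theorem is itself an instance of it: compare coefficients in
    exp((x_1 + ... + x_N) t) = exp(x_1 t) ... exp(x_N t). *)

(** * Coefficients of products of power series *)

Lemma coef_fps_mul {A : comNzRingType} (f g : fps A) (n : nat) :
  (f * g) n = \sum_(k < n.+1) f k * g (n - k)%N.
Proof. by []. Qed.

Lemma coef_fps_sum {A : comNzRingType} {I : Type} (s : seq I) (f : I -> fps A)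
    (n : nat) :
  (\sum_(i <- s) f i) n = \sum_(i <- s) f i n.
Proof. exact: (big_morph (fun g : fps A => g n)). Qed.

Lemma coef_fps_mulrn {A : comNzRingType} (f : fps A) (k n : nat) :
  (f *+ k) n = f n *+ k.
Proof. by elim: k => // k IHk; rewrite !mulrS -IHk. Qed.

(** Truncating to polynomials gives access to the theory of polynomial
    coefficients. *)
Definition truncation {A : comNzRingType} (M : nat) (f : fps A) : {poly A} :=
  \poly_(k < M) f k.

(** A coefficient of index below [M] in a product involves only coefficients of
    index below [M] in the factors, so having the same coefficients below [M]
    is a relation compatible with products. *)
Lemma coef_fps_prod_trunc {A : comNzRingType} {I : finType} (f : I -> fps A)
    {M n : nat} :
  (n < M)%N -> (\prod_i f i) n = (\prod_i truncation M (f i))`_n.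
Proof.
move: n; pose agree (g : fps A) (p : {poly A}) :=
  forall n, (n < M)%N -> g n = p`_n.
apply: (big_ind2 agree) => [n _|g p h q gp hq n lt_nM|i _ n lt_nM].
- by rewrite coef1.
- rewrite coef_fps_mul coefM; apply: eq_bigr => -[k /= le_kn] _.
  by rewrite gp ?hq // (leq_ltn_trans _ lt_nM) ?leq_subr.
by rewrite coef_poly lt_nM.
Qed.

(** Distributing the product of the truncated factors picks one exponent [t i]
    in each factor, and the resulting monomial has degree [\sum_i t i]. Any
    bound [M] above [n] will do, so that the index set can be chosen to match
    the one at hand. *)
Lemma coef_fps_prod {A : comNzRingType} {I : finType} (f : I -> fps A)
    {M n : nat} :
  (n < M)%N ->
  (\prod_i f i) n =
  \sum_(t : {ffun I -> 'I_M} | (\sum_i t i == n)%N) \prod_i f i (t i).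
Proof.
move=> lt_nM; rewrite (coef_fps_prod_trunc _ lt_nM) /truncation.
under eq_bigr do rewrite poly_def.
rewrite bigA_distr_bigA /= coef_sum [RHS]big_mkcond /=; apply: eq_bigr => t _.
rewrite scaler_prod -expr_sum coefZ coefXn eq_sym.
by case: eqP => _; rewrite (mulr1, mulr0).
Qed.

Lemma coef_fps_exp_low {A : comNzRingType} (f g : fps A) (m n : nat) :
  f 0%N = 0 -> (n < m)%N -> (f ^+ m * g) n = 0.
Proof.
move=> f0; elim: m n => // m IHm n; rewrite ltnS => le_nm.
rewrite exprS -mulrA coef_fps_mul big_ord_recl f0 mul0r add0r.
rewrite big1 // => -[k lt_kn] _.
rewrite IHm ?mulr0 // (leq_trans _ le_nm) //= /bump add1n ltn_subrL.
by rewrite (leq_ltn_trans _ lt_kn).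
Qed.

(** * The negative binomial expansion *)

Section NegativeBinomial.
Context {A : comNzRingType}.
Implicit Types (x : A) (r n : nat).

Definition neg_binomial r n x : A := \sum_(j < n.+1) x ^+ j *+ 'C(r + j - 1, j).

(** The truncated subtraction makes the coefficient of x^j equal to
    'C(j - 1, j) when r = 0, which is 1 for j = 0 and vanishes otherwise. *)
Lemma neg_binomial0 n x : neg_binomial 0 n x = 1.
Proof.
rewrite /neg_binomial big_ord_recl bin0 big1 ?addr0 // => j _.
by rewrite bin_small // lift0 add0n subn1.
Qed.

(** By Pascal's rule, multiplication by 1 - x lowers the order of the negative
    binomial series by one; truncation leaves a single boundary term. *)
Lemma mul_neg_binomialS r n x :
  (1 - x) * neg_binomial r.+1 n x =
  neg_binomial r n x - x ^+ n.+1 *+ 'C(r + n, n).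
Proof.
rewrite /neg_binomial; elim: n => [|n IHn].
  by rewrite !big_ord1 !bin0 !mulr1n mulr1 expr1.
have pascal : 'C(r + n.+1, n.+1) = ('C(r + n, n.+1) + 'C(r + n, n))%N.
  by rewrite addnS binS.
rewrite big_ord_recr [in RHS]big_ord_recr /= mulrDr IHn addSn !subn1 /=.
rewrite pascal addnS /= -!(mulr_natr (_ ^+ _)) natrD [x ^+ n.+2]exprS.
ring.
Qed.

(** A form of (1 - x)^-r = \sum_j 'C(r + j - 1, j) x^j that makes sense without
    any topology. *)
Lemma exp_mul_neg_binomial r n x :
  exists q, (1 - x) ^+ r * neg_binomial r n x = 1 + x ^+ n.+1 * q.
Proof.
elim: r => [|r [q IHr]].
  by exists 0; rewrite neg_binomial0 mulr0 mulr1 addr0.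
exists (q - (1 - x) ^+ r *+ 'C(r + n, n)).
rewrite exprSr -mulrA mul_neg_binomialS mulrBr IHr mulrBr addrA.
by rewrite !mulrnAr [_ * (1 - x) ^+ r]mulrC.
Qed.

End NegativeBinomial.

(** The error term x^(n+1) q of the truncated expansion becomes a multiple of
    f^(n+1), which does not reach the coefficient of index [n]. *)
Lemma coef_inv_exp_sub1 {A : comUnitRingType} (f : fps A) (r n : nat) :
  f 0%N = 0 ->
  ((1 - f) ^+ r)^-1 n = \sum_(j < n.+1) (f ^+ j) n *+ 'C(r + j - 1, j).
Proof.
move=> f0; have [q def_q] := exp_mul_neg_binomial r n f.
have unit_1f : (1 - f) ^+ r \is a GRing.unit.
  apply: unitrX; rewrite qualifE /= /fps_unit inE /=.
  by rewrite f0 subr0 unitr1.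
have -> : ((1 - f) ^+ r)^-1 =
          neg_binomial r n f - f ^+ n.+1 * (q * ((1 - f) ^+ r)^-1).
  apply: (mulrI unit_1f); rewrite mulrBr def_q [_ * (f ^+ _ * _)]mulrCA.
  by rewrite [_ * (q * _)]mulrCA mulrV // mulr1 addrK.
have subE (g h : fps A) : (g - h) n = g n - h n by [].
rewrite subE coef_fps_exp_low // subr0 coef_fps_sum.
by apply: eq_bigr => j _; rewrite coef_fps_mulrn.
Qed.

(** * Powers as sums over compositions *)

(** Expanding the product of j factors gives a sum over all j-tuples of
    exponents with sum [n]; those with a zero entry contribute nothing because
    the series has zero constant term. *)
Lemma coef_fps_pos_exp {R : comNzRingType} (d : nat -> R) (n j : nat) :
  (fps_pos d ^+ j) n = composition_sum d n j.
Proof.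
rewrite -[in LHS](card_ord j) -prodr_const (coef_fps_prod _ (ltnSn n)).
rewrite /composition_sum big_mkcondl /=.
rewrite (reindex (fun t : j.-tuple 'I_n.+1 => [ffun i => tnth t i])) /=;
  last first.
  exists (fun f => [tuple f i | i < j]) => [t|f] _.
    by apply: eq_from_tnth => i; rewrite tnth_mktuple ffunE.
  by apply/ffunP => i; rewrite ffunE tnth_mktuple.
apply: eq_big => [t|t _]; first by under eq_bigr do rewrite ffunE.
case: ifP => [/forallP t_gt0|/forallPn[i]].
  by apply: eq_bigr => i _; rewrite ffunE -if_neg -lt0n t_gt0.
by rewrite -eqn0Ngt => t_i0; rewrite (bigD1 i) //= ffunE t_i0 mul0r.
Qed.

(** * The multinomial theorem and Bell polynomials *)

Section Multinomial.
Context {F : numFieldType} {A : comAlgType F}.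

(** The series exp(x t) in the variable t. *)
Definition exp_fps (x : A) : fps A := Fps (fun k => k`!%:R^-1 *: x ^+ k).

Lemma fact_neq0 m : m`!%:R != 0 :> F.
Proof. by rewrite pnatr_eq0 -lt0n fact_gt0. Qed.

Lemma exp_fps0 : exp_fps 0 = 1.
Proof.
apply: fpsP => -[|n] /=; first by rewrite invr1 scale1r.
by rewrite expr0n scaler0.
Qed.

Lemma exp_fpsD (x y : A) : exp_fps (x + y) = exp_fps x * exp_fps y.
Proof.
apply: fpsP => n; rewrite coef_fps_mul /= addrC exprDn scaler_sumr.
apply: eq_bigr => -[k /= le_kn] _; rewrite mulrC.
rewrite -scalerAr -scalerAl scalerA -scaler_nat scalerA; congr (_ *: _).
rewrite -(bin_fact (le_kn : (k <= n)%N)) !natrM !invfM mulrAC mulVf ?mul1r //.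
  by rewrite mulrC.
by rewrite pnatr_eq0 -lt0n bin_gt0.
Qed.

(** Compare the coefficients of t^j in exp(t \sum_i x_i) = \prod_i exp(t x_i):
    on the left it is the j-th power of the sum over j!, and on the right the
    factor with index [i] contributes x_i^(m_i) / m_i!. *)
Lemma multinomial {I : finType} (x : I -> A) (M j : nat) :
  (j < M)%N ->
  (\sum_i x i) ^+ j =
  \sum_(m : {ffun I -> 'I_M} | (\sum_i m i == j)%N)
    (j`!%:R / (\prod_i (m i)`!)%:R) *: \prod_i x i ^+ m i.
Proof.
move=> lt_jM.
have := congr1 (fun f : fps A => f j)
  (big_morph _ exp_fpsD exp_fps0 (index_enum I) xpredT x).
rewrite (coef_fps_prod _ lt_jM) /= => /(congr1 (fun y => j`!%:R *: y)).
rewrite scalerA mulfV ?fact_neq0 // scale1r => ->.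
rewrite scaler_sumr; apply: eq_bigr => m _.
by rewrite scaler_prod scalerA natr_prod prodfV.
Qed.

End Multinomial.

(** Up to degree [n] the series is the sum of the monomials d_l z^l with
    1 <= l <= n, to which the multinomial theorem applies; the monomial indexed
    by the multiplicities m_l has degree \sum_l l m_l. Since m_l <= j <= n, the
    multiplicities range over exactly the index type of [bell]. *)
Lemma coef_fps_pos_exp_bell {F : numFieldType} (d : nat -> F) (n j : nat) :
  (j <= n)%N ->
  (fps_pos d ^+ j) n =
  j`!%:R / n`!%:R * bell n j (fun l => l`!%:R * d l).
Proof.
move=> le_jn.
rewrite -[in LHS](card_ord j) -prodr_const (coef_fps_prod_trunc _ (ltnSn n)).
rewrite prodr_const card_ord /truncation poly_def big_ord_recl /= scale0r add0r.
(* With the zero constant term split off, the index i stands for the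
   exponent l = i + 1. *)
rewrite (multinomial _ _ _ (le_jn : (j < n.+1)%N)) coef_sum.
rewrite /bell big_mkcondr mulr_sumr /=; apply: eq_bigr => m _; rewrite coefZ.
under [\prod_(_ < _) (_ *: _) ^+ _]eq_bigr do rewrite exprZn -exprM /bump add1n.
rewrite scaler_prod -expr_sum coefZ coefXn eq_sym.
case: eqP => _; last by rewrite !mulr0.
rewrite mulr1 mulrA; congr (_ * _).
  by rewrite [RHS]mulrA divfK // fact_neq0.
by apply: eq_bigr => i _; rewrite mulrAC mulfV ?mul1r // fact_neq0.
Qed.

Lemma rising_bin (r j : nat) : rising r j = ('C(r + j - 1, j) * j`!)%N.
Proof.
rewrite bin_ffact /rising; elim: j => [|j IHj]; first by rewrite big_ord0.
by rewrite big_ord_recr /= IHj addnS !subn1 /= ffactnS mulnC.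
Qed.

Theorem theorem4p3 (R : realType) (r : nat) (d : nat -> R) (c : nat -> R)
  (r_ge1 : (1 <= r)%N)
  (d_gt0 : forall n : nat, (1 <= n)%N -> 0 < d n)
  (c_def : 1 / (1 - fps_pos d) ^+ r = Fps c)
  (n : nat) (n_ge1 : (1 <= n)%N) :
  c n = \sum_(1 <= j < n.+1) 'C(r + j - 1, j)%:R * composition_sum d n j /\
  c n = 1 / n`!%:R *
        \sum_(1 <= j < n.+1)
          (rising r j)%:R * bell n j (fun l : nat => l`!%:R * d l).
Proof.
have c_n : c n = \sum_(1 <= j < n.+1) 'C(r + j - 1, j)%:R * (fps_pos d ^+ j) n.
  have -> : c n = ((1 - fps_pos d) ^+ r)^-1 n by rewrite -[_^-1]mul1r c_def.
  rewrite coef_inv_exp_sub1 // big_ord_recl big_add1 big_mkord.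
  rewrite (_ : (fps_pos d ^+ 0) n = 0); last first.
    by rewrite expr0 /= -[n]prednK.
  by rewrite mul0rn add0r; apply: eq_bigr => j _; rewrite mulr_natl.
rewrite c_n; split.
  by apply: eq_bigr => j _; rewrite coef_fps_pos_exp.
rewrite mulr_sumr; apply: eq_big_nat => j /andP[_ le_jn].
rewrite coef_fps_pos_exp_bell // rising_bin natrM div1r -!mulrA.
by rewrite [RHS]mulrCA; congr (_ * _); rewrite mulrCA.
Qed.
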